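(* Consider the closed-loop system formed by the power network dynamics, the generation and controllable demand dynamics, and the Extended Primal-Dual scheme, as specified in the context. Let $q_{k,j}(m_{k,j}+h_{k,j})=1$ for all $k\in\mathcal N^G_j$, $j\in\mathcal N$, and $q_{k,j}h_{k,j}=1$ for all $k\in\mathcal N^L_j$, $j\in\mathcal N$. Then the equilibrium values $p^{M,*}=[p^{M,*}_{k,j}]$ and $d^{c,*}=[d^{c,*}_{k,j}]$ of the system (at any equilibrium) globally minimize the optimization problem $$\min_{p^M,d^c}\ \sum_{j\in\mathcal N}\Big(\sum_{k\in\mathcal N^G_j}\tfrac12 q_{k,j}(p^M_{k,j})^2+\sum_{k\in\mathcal N^L_j}\tfrac12 q_{k,j}(d^c_{k,j})^2\Big)$$ $$\text{subject to}\quad \sum_{j\in\mathcal N}\Big(\sum_{k\in\mathcal N^G_j}p^M_{k,j}-\sum_{k\in\mathcal N^L_j}d^c_{k,j}-\sum_{k\in\mathcal N_j}p^L_{k,j}\Big)=0 .$$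
   Context: Network. $(\mathcal N,\mathcal E)$ is a finite connected graph (buses and lines), with an arbitrary orientation of its edges, so that $(i,j)\in\mathcal E$ implies $(j,i)\notin\mathcal E$. For $j\in\mathcal N$, $\mathcal N^p_j=\{k:(k,j)\in\mathcal E\}$ and $\mathcal N^s_j=\{k:(j,k)\in\mathcal E\}$. At each bus $j$ there is a finite set $\mathcal N^G_j$ of generation units and a finite set $\mathcal N^L_j$ of controllable loads (disjoint), and $\mathcal N_j=\mathcal N^G_j\cup\mathcal N^L_j$ is the set of active units at bus $j$. Units are indexed by pairs $(k,j)$ with $k\in\mathcal N_j$, $j\in\mathcal N$; $\widetilde{\mathcal N}$ is the set of all active units in the network (the union over $j$ of the $\mathcal N_j$). The real numbers $q_{k,j}$ are cost coefficients of the units. Power network dynamics (real-valued, continuous time): $\dot\eta_{ij}=\omega_i-\omega_j$, $(i,j)\in\mathcal E$; $M_j\dot\omega_j=\sum_{k\in\mathcal N^G_j}p^M_{k,j}-\sum_{k\in\mathcal N^L_j}d^c_{k,j}-\sum_{k\in\mathcal N_j}p^L_{k,j}-D_j\omega_j-\sum_{i\in\mathcal N^s_j}p_{ji}+\sum_{i\in\mathcal N^p_j}p_{ij}$, $j\in\mathcal N$; $p_{ij}=B_{ij}\eta_{ij}$, $(i,j)\in\mathcal E$; with constants $B_{ij}>0$, $M_j>0$, $D_j>0$, and constant uncontrollable demands $p^L_{k,j}\in\mathbb R$. Generation and controllable demand dynamics: $\tau_{k,j}\dot x_{k,j}=-x_{k,j}+m_{k,j}(u_{k,j}-\omega_j)$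 and $p^M_{k,j}=x_{k,j}+h_{k,j}(u_{k,j}-\omega_j)$ for $k\in\mathcal N^G_j$, $j\in\mathcal N$; $d^c_{k,j}=-h_{k,j}(u_{k,j}-\omega_j)$ for $k\in\mathcal N^L_j$, $j\in\mathcal N$; with constants $\tau_{k,j},m_{k,j},h_{k,j}>0$. Prosumption vector: $\widetilde s\in\mathbb R^{|\widetilde{\mathcal N}|}$ has entries $\widetilde s_{k,j}=-p^M_{k,j}+p^L_{k,j}$ for $k\in\mathcal N^G_j$ and $\widetilde s_{k,j}=d^c_{k,j}+p^L_{k,j}$ for $k\in\mathcal N^L_j$. Extended Primal-Dual scheme. $(\widetilde{\mathcal N},\widetilde{\mathcal E})$ is a connected (communication) graph with incidence matrix $H\in\mathbb R^{|\widetilde{\mathcal N}|\times|\widetilde{\mathcal E}|}$, where $H_{ie}=+1$ if $i$ is the positive end of edge $e$, $-1$ if $i$ is the negative end of $e$, and $0$ otherwise. The scheme is $\widetilde\Gamma\dot\psi=H^Tp^c$, $\quad\Gamma\dot p^c=\widetilde s-H\psi$, $\quad u=p^c$, where $\psi\in\mathbb R^{|\widetilde{\mathcal E}|}$, $p^c=[p^c_{k,j}]\in\mathbb R^{|\widetilde{\mathcal N}|}$, $u=[u_{k,j}]$, and $\widetilde\Gamma,\Gamma$ are diagonal matrices with positive diagonal entries. An equilibrium is a point $(\eta^*,\psi^*,\omega^*,x^*,p^{c,*})$ at which all time derivatives of the closed-loop system are zero; $p^{M,*}$, $d^{c,*}$ are the values of $p^M$, $d^c$ at that point. *)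

(* Defs.v *)
From mathcomp Require Import all_boot all_order all_algebra.
From mathcomp Require Import reals.

Set Implicit Arguments.
Unset Strict Implicit.
Unset Printing Implicit Defensive.

Import Order.TTheory GRing.Theory Num.Theory.
Local Open Scope ring_scope.

(** * Oriented finite graphs *)

(* A simple graph on [T] is given by the relation [e] of its oriented edges:
   each edge {x, y} appears as exactly one of (x, y) and (y, x). *)
Definition oriented (T : finType) (e : rel T) : Prop :=
  forall x y, e x y -> ~~ e y x.

(* Connectivity ignores the orientation. *)
Definition connected_graph (T : finType) (e : rel T) : Prop :=
  forall x y, connect [rel a b | e a b || e b a] x y.

Definition edge (T : finType) (e : rel T) : finType := {p : T * T | e p.1 p.2}.

Definition src (T : finType) (e : rel T) (l : edge e) : T := (val l).1.
Definition dst (T : finType) (e : rel T) (l : edge e) : T := (val l).2.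

(* The positive end of an edge is its source. Loops being excluded by
   [oriented], the two tests never hold together. *)
Definition incidence (R : realType) (T : finType) (e : rel T) :
    'M[R]_(#|T|, #|edge e|) :=
  \matrix_(i, l)
    (if enum_val i == src (enum_val l) then 1
     else if enum_val i == dst (enum_val l) then -1 else 0).

(** * The power network *)

Record network := Network {
  bus : finType;
  line : rel bus;
  line_oriented : oriented line;
  line_connected : connected_graph line;
  gen : bus -> finType;
  load : bus -> finType
}.

(* The set of active units at bus [j]; the sum type renders the disjointness
   of the generation units and the controllable loads. *)
Definition unit_at (net : network) (j : bus net) : finType :=
  (gen j + load j)%type.

(* The pair (k, j) is the dependent pair with tag [j] and value [k]. *)
Definition active_unit (net : network) : finType :=
  {j : bus net & unit_at j}.

Definition gen_unit (net : network) (j : bus net) (k : gen j) :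
    active_unit net :=
  Tagged (@unit_at net) (inl k : unit_at j).

Definition load_unit (net : network) (j : bus net) (k : load j) :
    active_unit net :=
  Tagged (@unit_at net) (inr k : unit_at j).

Record plant (R : realType) (net : network) := Plant {
  B : edge (@line net) -> R;
  M : bus net -> R;
  D : bus net -> R;
  tau : forall j : bus net, gen j -> R;
  m : forall j : bus net, gen j -> R;
  h : active_unit net -> R;
  pL : active_unit net -> R;
  B_gt0 : forall l, 0 < B l;
  M_gt0 : forall j, 0 < M j;
  D_gt0 : forall j, 0 < D j;
  tau_gt0 : forall j (k : gen j), 0 < tau k;
  m_gt0 : forall j (k : gen j), 0 < m k;
  h_gt0 : forall v, 0 < h v
}.

(* The diagonal gain matrices are given by their diagonals, as row vectors:
   [Gamma_psi] for the edge variables, [Gamma_p] for the unit variables. *)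
Record primal_dual (R : realType) (net : network) := PrimalDual {
  comm : rel (active_unit net);
  comm_oriented : oriented comm;
  comm_connected : connected_graph comm;
  Gamma_psi : 'rV[R]_#|edge comm|;
  Gamma_p : 'rV[R]_#|active_unit net|;
  Gamma_psi_gt0 : forall l, 0 < Gamma_psi 0 l;
  Gamma_p_gt0 : forall i, 0 < Gamma_p 0 i
}.

(** * The closed loop *)

Record state (R : realType) (net : network) (ctl : primal_dual R net) := State {
  eta : edge (@line net) -> R;
  psi : 'cV[R]_#|edge (comm ctl)|;
  omega : bus net -> R;
  x : forall j : bus net, gen j -> R;
  pc : 'cV[R]_#|active_unit net|
}.

Section ClosedLoop.
Variables (R : realType) (net : network).
Variables (par : plant R net) (ctl : primal_dual R net).
Implicit Types s ds : state ctl.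

Definition u s (v : active_unit net) : R := pc s (enum_rank v) 0.

Definition p s (l : edge (@line net)) : R := B par l * eta s l.

Definition pM s (j : bus net) (k : gen j) : R :=
  x s k + h par (gen_unit k) * (u s (gen_unit k) - omega s j).

Definition dc s (j : bus net) (k : load j) : R :=
  - (h par (load_unit k) * (u s (load_unit k) - omega s j)).

Definition prosumption s : 'cV[R]_#|active_unit net| :=
  \col_i (let v := enum_val i in
          match tagged v with
          | inl k => - pM s k + pL par v
          | inr k => dc s k + pL par v
          end).

(* The differential equations, as a relation between a state [s] and the
   vector [ds] of the time derivatives of its components. The sums over the
   successors and predecessors of [j] range over the lines leaving and
   entering [j]. *)
Record closed_loop s ds : Prop := ClosedLoop {
  eta_eq : forall l : edge (@line net),
    eta ds l = omega s (src l) - omega s (dst l);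
  omega_eq : forall j : bus net,
    M par j * omega ds j =
      \sum_(k : gen j) pM s k - \sum_(k : load j) dc s k
      - \sum_(k : unit_at j) pL par (Tagged (@unit_at net) k)
      - D par j * omega s j
      - \sum_(l : edge (@line net) | src l == j) p s l
      + \sum_(l : edge (@line net) | dst l == j) p s l;
  x_eq : forall (j : bus net) (k : gen j),
    tau par k * x ds k =
      - x s k + m par k * (u s (gen_unit k) - omega s j);
  psi_eq :
    diag_mx (Gamma_psi ctl) *m psi ds = (incidence R (comm ctl))^T *m pc s;
  pc_eq :
    diag_mx (Gamma_p ctl) *m pc ds =
      prosumption s - incidence R (comm ctl) *m psi s
}.

Definition zero_state : state ctl :=
  @State R net ctl (fun=> 0) 0 (fun=> 0) (fun _ _ => 0) 0.

Definition equilibrium s : Prop := closed_loop s zero_state.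

End ClosedLoop.

(** * The optimization problem *)

Record dispatch (R : realType) (net : network) := Dispatch {
  gen_power : forall j : bus net, gen j -> R;
  load_power : forall j : bus net, load j -> R
}.

Definition cost (R : realType) (net : network) (q : active_unit net -> R)
    (z : dispatch R net) : R :=
  \sum_(j : bus net)
    (\sum_(k : gen j) 2^-1 * q (gen_unit k) * gen_power z k ^+ 2
     + \sum_(k : load j) 2^-1 * q (load_unit k) * load_power z k ^+ 2).

Definition balanced (R : realType) (net : network) (par : plant R net)
    (z : dispatch R net) : Prop :=
  \sum_(j : bus net)
    (\sum_(k : gen j) gen_power z k - \sum_(k : load j) load_power z k
     - \sum_(k : unit_at j) pL par (Tagged (@unit_at net) k)) = 0.

Definition global_minimizer (R : realType) (T : Type) (feasible : T -> Prop)
    (f : T -> R) (z : T) : Prop :=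
  feasible z /\ forall z', feasible z' -> f z <= f z'.

(* Main.v *)
(** At an equilibrium [H^T p^c = 0] forces [p^c] to be constant, and
    [omega] is constant because [eta] is stationary. Hence the number
    [lambda = u - omega] is the same at every unit, and the unit dynamics and
    the choice of [q] turn it into the common marginal cost:
    [q p^M = lambda] and [q d^c = - lambda]. The columns of [H] sum to zero, so
    the prosumption vector [H psi] sums to zero, which is the power balance.
    Since the cost is convex and its gradient is [lambda] times the
    coefficients of the balance constraint, the equilibrium is optimal. *)
Require Import Defs.
From mathcomp Require Import all_boot all_order all_algebra.
From mathcomp Require Import reals.
From mathcomp Require Import ring lra.

Set Implicit Arguments.
Unset Strict Implicit.
Unset Printing Implicit Defensive.

Import Order.TTheory GRing.Theory Num.Theory.
Local Open Scope ring_scope.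

Lemma connected_graph_const (T : finType) (e : rel T) (A : Type) (f : T -> A) :
  connected_graph e -> (forall a b, e a b -> f a = f b) ->
  forall a b, f a = f b.
Proof.
move=> conn_e fe a b; have /connectP[r path_r ->] := conn_e a b.
elim: r a path_r => //= c r IHr a /andP[eac path_r].
by rewrite -(IHr c path_r); case/orP: eac => /fe.
Qed.

(** Each column of the incidence matrix has only two nonzero entries. They lie in different rows,
    since a loop would be its own reverse edge, which [oriented] forbids. *)
Lemma tr_incidence_mulE (R : realType) (T : finType) (e : rel T)
    (v : 'cV[R]_#|T|) (l : edge e) :
  oriented e ->
  ((incidence R e)^T *m v) (enum_rank l) 0
    = v (enum_rank (src l)) 0 - v (enum_rank (dst l)) 0.
Proof.
move=> or_e; have dst_neq_src : dst l != src l.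
  apply/eqP => eq_l; have := or_e _ _ (valP l).
  by have := valP l; rewrite -/(src l) -/(dst l) eq_l => ->.
rewrite mxE (bigD1 (enum_rank (src l))) //=.
rewrite (bigD1 (enum_rank (dst l))) /=; last by rewrite (inj_eq enum_rank_inj).
rewrite !mxE !enum_rankK !eqxx (negbTE dst_neq_src) big1; first by ring.
move=> i /andP[i_src i_dst]; rewrite !mxE enum_rankK.
rewrite -(inj_eq enum_rank_inj) enum_valK (negbTE i_src).
by rewrite -(inj_eq enum_rank_inj) enum_valK (negbTE i_dst) mul0r.
Qed.

(** The sum is [1^T H w], and [H^T 1 = 0] because a constant vector has no difference across any
    edge. *)
Lemma sum_incidence_mul (R : realType) (T : finType) (e : rel T)
    (w : 'cV[R]_#|edge e|) :
  oriented e -> \sum_i (incidence R e *m w) i 0 = 0.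
Proof.
move=> or_e; have H1 : (incidence R e)^T *m const_mx 1 = 0 :> 'cV[R]_#|edge e|.
  apply/colP => l; rewrite -(enum_valK l) tr_incidence_mulE // !mxE.
  by rewrite subrr.
transitivity (((const_mx 1 : 'cV[R]_#|T|)^T *m (incidence R e *m w)) 0 0).
  by rewrite [RHS]mxE; apply: eq_bigr => i _; rewrite !mxE mul1r.
by rewrite mulmxA -[incidence R e]trmxK -trmx_mul H1 trmx0 mul0mx mxE.
Qed.

Lemma sum_unit_at (R : realType) (net : network) (j : bus net)
    (F : active_unit net -> R) :
  \sum_(k : unit_at j) F (Tagged (@unit_at net) k)
    = \sum_(k : gen j) F (gen_unit k) + \sum_(k : load j) F (load_unit k).
Proof. by rewrite big_sumType. Qed.

Lemma sum_active_unit (R : realType) (net : network)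
    (F : active_unit net -> R) :
  \sum_v F v = \sum_j \sum_(k : unit_at j) F (Tagged (@unit_at net) k).
Proof. by rewrite sig_big_dep; apply: eq_bigr => -[]. Qed.

Section Equilibrium.
Variables (R : realType) (net : network).
Variables (par : plant R net) (ctl : primal_dual R net).
Variables (s : state ctl) (s_eq : equilibrium par s).

Lemma equilibrium_u_const (v w : active_unit net) : u s v = u s w.
Proof.
apply: (connected_graph_const (comm_connected ctl)) => a b ab.
have /colP/(_ (enum_rank (Sub (a, b) ab : edge (comm ctl)))) := psi_eq s_eq.
rewrite tr_incidence_mulE; last exact: comm_oriented.
by rewrite /src /dst /= mulmx0 mxE => /esym/eqP; rewrite subr_eq0 => /eqP.
Qed.

Lemma equilibrium_omega_const (i j : bus net) : omega s i = omega s j.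
Proof.
apply: (connected_graph_const (@line_connected net)) => a b ab.
have /esym/eqP := eta_eq s_eq (Sub (a, b) ab : edge (@line net)).
by rewrite subr_eq0 => /eqP.
Qed.

Lemma equilibrium_price :
  exists lambda, forall v, u s v - omega s (tag v) = lambda.
Proof.
(* The common value is read off an arbitrary unit; in a network without units any value serves, here
   0. *)
case: (pickP (@predT (active_unit net))) => [w _ | none].
  exists (u s w - omega s (tag w)) => v.
  by rewrite (equilibrium_u_const v w) (equilibrium_omega_const _ (tag w)).
by exists 0 => v; have := none v.
Qed.

(** Stationarity of [x] gives [x = m (u - omega)], so the dynamic and the direct gain add up. *)
Lemma equilibrium_pM (j : bus net) (k : gen j) :
  pM par s k
    = (m par k + h par (gen_unit k)) * (u s (gen_unit k) - omega s j).
Proof.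
have := x_eq s_eq k; rewrite mulr0 /pM => x_eq_k.
lra.
Qed.

Lemma equilibrium_balanced : balanced par (Dispatch (pM par s) (dc par s)).
Proof.
have /(congr1 (fun A : 'cV_ _ => \sum_i A i 0)) := pc_eq s_eq.
rewrite mulmx0 [in RHS](eq_bigr (fun i => prosumption par s i 0
  - (incidence R (comm ctl) *m psi s) i 0)); last by move=> i _; rewrite !mxE.
rewrite sumrB sum_incidence_mul ?subr0; last exact: comm_oriented.
rewrite big1 => [|i _]; last by rewrite mxE.
rewrite (reindex _ (onW_bij _ (@enum_rank_bij (active_unit net)))) /=.
rewrite sum_active_unit /balanced => /esym pros0.
(* Prosumption counts consumption as positive, so at each bus it sums to the opposite of the net
   power in the constraint. *)
apply/eqP; rewrite -oppr_eq0 -sumrN -[X in _ == X]pros0; apply/eqP.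
apply: eq_bigr => j _ /=.
rewrite sum_unit_at (sum_unit_at j (fun v => prosumption par s (enum_rank v) 0)).
rewrite [X in _ = X + _](eq_bigr (fun k => - pM par s k + pL par (gen_unit k)));
  last by move=> k _; rewrite mxE enum_rankK.
rewrite [X in _ = _ + X](eq_bigr (fun k => dc par s k + pL par (load_unit k)));
  last by move=> k _; rewrite mxE enum_rankK.
rewrite [X in _ = X + _]big_split [X in _ = _ + X]big_split /=.
rewrite [X in _ = X + _ + _]sumrN.
ring.
Qed.

End Equilibrium.

(** The gap between the parabola and its tangent at [a] is [c / 2 * (b - a) ^ 2]. *)
Lemma half_square_tangent (R : realFieldType) (c a b : R) :
  0 <= c -> 2^-1 * c * a ^+ 2 + c * a * (b - a) <= 2^-1 * c * b ^+ 2.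
Proof.
move=> c0; rewrite -subr_ge0.
have -> : 2^-1 * c * b ^+ 2 - (2^-1 * c * a ^+ 2 + c * a * (b - a))
  = 2^-1 * c * (b - a) ^+ 2 by field.
by apply: mulr_ge0 (sqr_ge0 _); apply: mulr_ge0; rewrite ?invr_ge0 ?ler0n.
Qed.

(** Sufficiency of the Lagrange condition for a convex cost, with [lambda] as the multiplier of the
    balance constraint. *)
Lemma common_marginal_cost_minimizes (R : realType) (net : network)
    (par : plant R net) (q : active_unit net -> R) (lambda : R)
    (z : dispatch R net) :
  (forall v, 0 <= q v) ->
  (forall j (k : gen j), q (gen_unit k) * gen_power z k = lambda) ->
  (forall j (k : load j), q (load_unit k) * load_power z k = - lambda) ->
  balanced par z -> global_minimizer (balanced par) (cost q) z.
Proof.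
move=> q_ge0 mc_gen mc_load bal_z; split=> // z' bal_z'.
pose net_power (y : dispatch R net) j :=
  \sum_(k : gen j) gen_power y k - \sum_(k : load j) load_power y k
  - \sum_(k : unit_at j) pL par (Tagged (@unit_at net) k).
(* The added term is zero because [z] and [z'] are both balanced. It supplies the linear parts of
   the tangents, so the comparison can be made bus by bus. *)
have -> : cost q z
  = cost q z + lambda * (\sum_j net_power z' j - \sum_j net_power z j).
  by rewrite /net_power bal_z bal_z' subrr mulr0 addr0.
rewrite -sumrB mulr_sumr /cost -big_split /=; apply: ler_sum => j _.
have gen_le : \sum_(k : gen j) (2^-1 * q (gen_unit k) * gen_power z k ^+ 2
    + lambda * (gen_power z' k - gen_power z k))
    <= \sum_(k : gen j) 2^-1 * q (gen_unit k) * gen_power z' k ^+ 2.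
  by apply: ler_sum => k _; rewrite -(mc_gen j k) half_square_tangent.
have load_le : \sum_(k : load j) (2^-1 * q (load_unit k) * load_power z k ^+ 2
    + - lambda * (load_power z' k - load_power z k))
    <= \sum_(k : load j) 2^-1 * q (load_unit k) * load_power z' k ^+ 2.
  by apply: ler_sum => k _; rewrite -(mc_load j k) half_square_tangent.
apply: le_trans (lerD gen_le load_le); rewrite !big_split /= -!mulr_sumr !sumrB.
(* What remains is an equality: the demands [pL] cancel between [z] and [z']. *)
by rewrite /net_power le_eqVlt; apply/orP; left; apply/eqP; ring.
Qed.

Theorem proposition2 (R : realType) (net : network)
    (par : plant R net) (ctl : primal_dual R net)
    (q : active_unit net -> R)
    (hq_gen : forall (j : bus net) (k : gen j),
       q (gen_unit k) * (m par k + h par (gen_unit k)) = 1)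
    (hq_load : forall (j : bus net) (k : load j),
       q (load_unit k) * h par (load_unit k) = 1)
    (s : state ctl) (s_eq : equilibrium par s) :
  global_minimizer (balanced par) (cost q)
    (Dispatch (pM par s) (dc par s)).
Proof.
have [lambda u_omega] := equilibrium_price s_eq.
apply: (@common_marginal_cost_minimizes _ _ _ _ lambda).
(* Convexity of the cost: [q] is the inverse of a positive gain. *)
- case=> j [k|k]; apply: ltW.
    rewrite -(pmulr_lgt0 _ (addr_gt0 (m_gt0 par k) (h_gt0 par (gen_unit k)))).
    by rewrite hq_gen.
  by rewrite -(pmulr_lgt0 _ (h_gt0 par (load_unit k))) hq_load.
- move=> j k /=; rewrite (equilibrium_pM s_eq) mulrA hq_gen mul1r.
  exact: u_omega (gen_unit k).
- move=> j k /=; rewrite /dc mulrN mulrA hq_load mul1r.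
  by rewrite -(u_omega (load_unit k)).
- exact: equilibrium_balanced.
Qed.
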